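(* Let $\mathcal L$ be a Lusin-gap and let $\mathcal L=\bigcup\{\Delta_{\mathcal L}(k):k\in\mathbb Z\}$, where the sets $\Delta_{\mathcal L}(k)$ are uncountable and pairwise disjoint. Let $\mathbf Y_{\mathcal L}$ and $\mathbf Y_{\mathcal L}^*=\mathbf Y_{\mathcal L}\cup\{-\infty,+\infty\}$ be constructed from $X=\Psi(\mathcal L)$, $\Delta_X=\mathcal L$ and $\Delta_X(k)=\Delta_{\mathcal L}(k)$ as described in the context. Then $\mathbf Y_{\mathcal L}$ is completely regular; the subspaces $\mathbf Y_{\mathcal L}\cup\{-\infty\}$ and $\mathbf Y_{\mathcal L}\cup\{+\infty\}$ of $\mathbf Y_{\mathcal L}^*$ and the space $\mathbf Y_{\mathcal L}^*$ are regular; and if $f:\mathbf Y_{\mathcal L}^*\to\mathbb R$ is a continuous real valued function, then $f(+\infty)=f(-\infty)$.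
   Context: Regular and completely regular spaces are assumed to be $T_1$. A family of sets is almost disjoint if any two distinct members have finite intersection. A set $C$ separates two families if $B\setminus C$ is finite for each member $B$ of the first family and $B\cap C$ is finite for each member $B$ of the second family. A Lusin-gap is an uncountable almost disjoint family $\mathcal L$ of infinite subsets of $\omega$ such that no two uncountable disjoint subfamilies of $\mathcal L$ can be separated by a subset of $\omega$. The space $\Psi(\mathcal L)=\mathcal L\cup\omega$ has the topology generated by all subsets of $\omega$ and all sets $\{A\}\cup(A\setminus F)$ with $A\in\mathcal L$ and $F$ finite. General construction. Let $X$ be a space and $\Delta_X\subseteq X$ a closed discrete subset partitioned into sets $\Delta_X(k)$, $k\in\mathbb Z$. For $x\in X\setminus\Delta_X$ and $k\in\mathbb Z$ put $\mathbf x_k=(k,x)$; for $x\in\Delta_X(k)$ put $\mathbf x_k=\{(k,x),(k+1,x)\}$ (so for $x\in\Delta_X$ the point $\mathbf x_k$ is defined only for the unique $k$ with $x\in\Delta_X(k)$). Let $\mathbf Y=\mathbf Y_X$ be the set of all points $\mathbf x_k$ so defined. Its topology is generated by: the sets $\{\mathbf x_k:x\in V\}$, for $k\in\mathbb Z$ and $V\subseteq X\setminus\Delta_X$ open in $X$; and the sets $\{\mathbf x_k:x\in V\cap((X\setminus\Delta_X)\cup\Delta_X(k))\}\cup\{\mathbf x_{k+1}:x\in V\setminus\Delta_X\}$, for $k\in\mathbb Z$ and $V\subseteq X$ open. Put $\Delta_{\mathbf Y}(k)=\{\mathbf x_k:x\in\Delta_X(k)\}$ and $\mathbf Y_k=\{\mathbf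 x_k:x\in X\setminus\Delta_X\}$. In $\mathbf Y^*=\mathbf Y\cup\{-\infty,+\infty\}$ ($\pm\infty$ distinct new points), open sets of $\mathbf Y$ are open; the sets $\{+\infty\}\cup\bigcup\{\mathbf Y_n:n\geqslant m\}\cup\bigcup\{\Delta_{\mathbf Y}(n):n>m\}$, $m\in\mathbb Z$, form a base at $+\infty$; the sets $\{-\infty\}\cup\bigcup\{\mathbf Y_n:n\leqslant m\}\cup\bigcup\{\Delta_{\mathbf Y}(n):n<m\}$, $m\in\mathbb Z$, form a base at $-\infty$. *)

(* Defs.v *)
From HB Require Import structures.
From mathcomp Require Import all_boot all_order all_algebra.
From mathcomp Require Import all_classical all_reals all_analysis.
Import numFieldNormedType.Exports.

Set Implicit Arguments.
Unset Strict Implicit.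
Unset Printing Implicit Defensive.

Local Open Scope classical_set_scope.
Local Open Scope ring_scope.

(** The library's [regular_space] and
    [completely_regular_space] do not include T1.  The latter separates points
    from closed sets by uniformities; [completely_regular_T1P] below is the
    formulation with real-valued functions. *)

Definition regular_T1 (T : topologicalType) : Prop :=
  accessible_space T /\ regular_space T.

Definition completely_regular_T1 (T : topologicalType) : Prop :=
  accessible_space T /\ completely_regular_space T.

Lemma completely_regular_T1P (R : realType) (T : topologicalType) :
  completely_regular_T1 T <->
  accessible_space T /\
  (forall (a : T) (B : set T), closed B -> ~ B a ->
    exists f : T -> R, [/\ continuous f, range f `<=` `[0, 1],
      f a = 0 & forall b, B b -> f b = 1]).
Proof.
split=> -[T1 cr]; split=> // a B clB Ba.
- have /(_ R)[f [cf f01 f0 f1]] := (uniform_separatorP _ _).1 (cr a B clB Ba).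
  exists f; split=> //; first by apply: f0; exists a.
  by move=> b Bb; apply: f1; exists b.
- apply/uniform_separatorP => //; have [f [cf f01 f0 f1]] := cr a B clB Ba.
  by exists f; split=> // _ [x /= xB <-]; [rewrite xB|exact: f1].
Qed.

Definition almost_disjoint (L : set (set nat)) : Prop :=
  forall A B, L A -> L B -> A <> B -> finite_set (A `&` B).

Definition separates (C : set nat) (M N : set (set nat)) : Prop :=
  (forall B, M B -> finite_set (B `\` C)) /\
  (forall B, N B -> finite_set (B `&` C)).

Definition Lusin_gap (L : set (set nat)) : Prop :=
  [/\ ~ countable L,
      (forall A, L A -> infinite_set A),
      almost_disjoint L &
      forall M N : set (set nat), M `<=` L -> N `<=` L ->
        ~ countable M -> ~ countable N -> M `&` N = set0 ->
        ~ exists C : set nat, separates C M N].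

Inductive Psi (L : set (set nat)) : Type :=
  | psi_set of set_type L
  | psi_nat of nat.

Arguments psi_set {L} _.
Arguments psi_nat {L} _.

HB.instance Definition _ (L : set (set nat)) := gen_eqMixin (Psi L).
HB.instance Definition _ (L : set (set nat)) := gen_choiceMixin (Psi L).

Definition Psi_gen (L : set (set nat)) : set (set (Psi L)) :=
  [set psi_nat @` S | S in [set: set nat]] `|`
  [set U | exists (A : set_type L) (F : set nat), finite_set F /\
     U = [set psi_set A] `|` psi_nat @` (\val A `\` F)].

Arguments Psi_gen L : clear implicits.

HB.instance Definition _ (L : set (set nat)) :=
  isSubBaseTopological.Build (Psi L) (Psi_gen L) id.

Definition Psi_Delta (L : set (set nat)) : set (Psi L) := range psi_set.

Arguments Psi_Delta L : clear implicits.

Definition Psi_Delta_part (L : set (set nat)) (D : int -> set (set nat))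
    (k : int) : set (Psi L) :=
  [set psi_set A | A in [set A : set_type L | D k (\val A)]].

Arguments Psi_Delta_part L D k : clear implicits.

(** The space Y built from a space X, a set Delta in X (meant to be closed and
    discrete) and a partition (D k) of Delta indexed by the integers.  The
    point x_k is encoded by the pair (k, x), whether x is outside Delta or in
    D k: in the second case k is determined by x, so replacing the point
    {(k, x), (k + 1, x)} by (k, x) is a bijective renaming. *)

Definition bfY (X : topologicalType) (Delta : set X) (D : int -> set X) : Type :=
  set_type [set p : int * X | ~ Delta p.2 \/ D p.1 p.2].

HB.instance Definition _ (X : topologicalType) (Delta : set X)
  (D : int -> set X) := Choice.copy (bfY Delta D)
    (set_type [set p : int * X | ~ Delta p.2 \/ D p.1 p.2]).

Section bfY_topology.
Context {X : topologicalType} (Delta : set X) (D : int -> set X).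

(** The set of all x_k with x in S (and x_k defined). *)
Definition layer (k : int) (S : set X) : set (bfY Delta D) :=
  [set y | (\val y).1 = k /\ S (\val y).2].

Definition bfY_gen : set (set (bfY Delta D)) :=
  [set U | exists (k : int) (V : set X),
     [/\ open V, V `<=` ~` Delta & U = layer k V]] `|`
  [set U | exists (k : int) (V : set X), open V /\
     U = layer k (V `&` (~` Delta `|` D k)) `|` layer (k + 1) (V `\` Delta)].

HB.instance Definition _ :=
  isSubBaseTopological.Build (bfY Delta D) bfY_gen id.

Definition bfY_Delta (k : int) : set (bfY Delta D) := layer k (D k).

Definition bfY_level (k : int) : set (bfY Delta D) := layer k (~` Delta).

End bfY_topology.

Arguments bfY_Delta {X} Delta D k.
Arguments bfY_level {X} Delta D k.

Inductive bfYs (X : topologicalType) (Delta : set X) (D : int -> set X) : Type :=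
  | ys_ninfty
  | ys_of of bfY Delta D
  | ys_pinfty.

Arguments ys_ninfty {X Delta D}.
Arguments ys_of {X Delta D} _.
Arguments ys_pinfty {X Delta D}.

HB.instance Definition _ (X : topologicalType) (Delta : set X)
  (D : int -> set X) := gen_eqMixin (bfYs Delta D).
HB.instance Definition _ (X : topologicalType) (Delta : set X)
  (D : int -> set X) := gen_choiceMixin (bfYs Delta D).

Section bfYs_topology.
Context {X : topologicalType} (Delta : set X) (D : int -> set X).

Definition pinfty_base (m : int) : set (bfYs Delta D) :=
  [set ys_pinfty] `|`
  ys_of @` (\bigcup_(n in [set n : int | m <= n]) bfY_level Delta D n `|`
            \bigcup_(n in [set n : int | m < n]) bfY_Delta Delta D n).

Definition ninfty_base (m : int) : set (bfYs Delta D) :=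
  [set ys_ninfty] `|`
  ys_of @` (\bigcup_(n in [set n : int | n <= m]) bfY_level Delta D n `|`
            \bigcup_(n in [set n : int | n < m]) bfY_Delta Delta D n).

(** When Delta is closed, the traces on Y of the sets [pinfty_base m] and
    [ninfty_base m] are open in Y; as these families are moreover decreasing
    and increasing in m, they are neighbourhood bases at +oo and -oo for the
    topology generated below. *)
Definition bfYs_gen : set (set (bfYs Delta D)) :=
  [set ys_of @` U | U in open] `|` range pinfty_base `|` range ninfty_base.

HB.instance Definition _ :=
  isSubBaseTopological.Build (bfYs Delta D) bfYs_gen id.

End bfYs_topology.

(** The subspace A of T as a space of its own.  (The library's [subspace A]
    has carrier T, with the points outside A isolated.) *)
Definition subspace_of (T : topologicalType) (A : set T) : topologicalType :=
  initial_topology (@set_val T A).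

(* Main.v *)
Require Import Defs.
From mathcomp Require Import all_boot all_order all_algebra.
From mathcomp Require Import all_classical all_reals all_analysis.
From mathcomp Require Import zify lra.
Import Order.TTheory GRing.Theory Num.Theory.
Import numFieldNormedType.Exports.

Local Open Scope classical_set_scope.
Local Open Scope ring_scope.

(** The points of Y over psi_nat n are isolated, and a point of Y over a
    member A of D k is the limit, as n runs through A, of the points of level k
    and of the points of level k + 1 over n ([Y_cvg]).  Conversely a set
    that contains almost all of these points whenever it contains their limit
    is open ([Y_open]).  As L is almost disjoint and each A lies in a single
    D k, a point over A has a neighbourhood base of clopen sets consisting of
    that point and of points over elements of A ([Y_clopen_nbhs]), hence Y is
    completely regular.  Such clopen sets live on two consecutive levels,
    so they stay clopen when the two points at infinity are added.  At +oo and
    -oo the basic neighbourhoods on the two sides are complementary up to a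
    shift of the level, which bounds their closures ([Ys_regular_T1]).

    Let g be continuous and real valued on Y with its two ends.  Both an A in
    D k and a B in D (k + 1) are limits of the level k + 1: the values
    r n = g (k + 1, n) tend along A to the value of g over A, and along B to
    the value of g over B.  If, for some c < d, uncountably many A in D k had
    a value < c and uncountably many B in D (k + 1) a value >= d, then
    {n | r n < (c + d) / 2} would separate two disjoint uncountable subfamilies
    of the Lusin gap.  Hence, if uncountably many values over D k are < c, then
    all but countably many values over D (k + 1) are < d ([below_succ]).
    Climbing from level to level from -oo, where the values are near g(-oo),
    to +oo, one can lose as little as desired at each step, so that
    g(+oo) <= g(-oo) ([ends_le]); applying this to - g gives equality. *)

(** * Subbases, clopen neighbourhoods and subspaces *)

Section general_topology.
Implicit Type T : topologicalType.

(** A filter contains the finite intersections of its members, so convergence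
    can be tested on the subbase.  The hypothesis [openG] holds by computation
    for every topology built from a subbase. *)
Lemma subbase_cvg {T} (G : set_system T)
    (openG : open = [set \bigcup_(B in E) B | E in subset^~ (finI_from G id)])
    (F : set_system T) (x : T) : Filter F ->
  (forall U, G U -> U x -> F U) -> F --> x.
Proof.
move=> FF FG U; rewrite nbhsE => -[V [oV Vx] VU].
move: oV Vx VU; rewrite openG => -[E sE <-] [B EB Bx] VU.
apply: (filterS VU).
apply: (@filterS _ _ _ B) => [z Bz|]; first by exists B.
have [H sH BE] := sE _ EB; rewrite -BE; apply: filter_bigI => V' VH.
by apply: FG; [apply: set_mem; exact: sH|move: Bx; rewrite -BE; exact].
Qed.

Lemma subbase_open {T} (G : set_system T)
    (openG : open = [set \bigcup_(B in E) B | E in subset^~ (finI_from G id)])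
    (U : set T) : G U -> open U.
Proof.
move=> GU; rewrite openG; exists [set U]; last exact: bigcup_set1.
by move=> _ ->; exact: (@finI_from1 _ _ G id).
Qed.

Lemma closure_disjoint_open {T} (U V : set T) :
  open V -> U `<=` ~` V -> closure U `<=` ~` V.
Proof.
move=> oV UV; rewrite [X in _ `<=` X](closure_id _).1; last exact: open_closedC.
exact: closureS.
Qed.

(** The indicator function of the complement of a clopen set is locally
    constant, hence continuous. *)
Lemma clopen_completely_regular (R : realType) {T} : accessible_space T ->
  (forall (x : T) W, nbhs x W -> exists C, [/\ clopen C, C x & C `<=` W]) ->
  completely_regular_T1 T.
Proof.
move=> T1 base; apply/(completely_regular_T1P R).
split=> // a B cB Ba.
have [|C [[oC cC] Ca CB]] := base a (~` B).
  by apply: open_nbhs_nbhs; split=> //; exact: closed_openC.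
exists \1_(~` C); split.
- move=> x; apply: (@cvg_near_cst _ _ _ _ (nbhs x)).
  have [Cx|nCx] := pselect (C x).
    apply: (@filterS _ (nbhs x) _ C) => [y Cy|]; last exact: open_nbhs_nbhs.
    by rewrite !indicE !memNset.
  apply: (@filterS _ (nbhs x) _ (~` C)) => [y Cy|].
    by rewrite !indicE !mem_set.
  by apply: open_nbhs_nbhs; split=> //; exact: closed_openC.
- move=> _ [x _ <-]; rewrite indicE/= in_itv/=.
  by rewrite ler0n lern1 leq_b1.
- by rewrite indicE memNset.
- by move=> b Bb; rewrite indicE mem_set// => /CB.
Qed.

Lemma regular_T1_subspace {T} (A : set T) :
  regular_T1 T -> regular_T1 (subspace_of A).
Proof.
have cont : continuous (set_val : subspace_of A -> T).
  exact: initial_continuous.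
move=> [T1 reg]; split.
- move=> x y xy; have [|U [oU Ux Uy]] := T1 (set_val x) (set_val y).
    by apply: contra xy => /eqP/val_inj ->.
  exists (set_val @^-1` U).
  by split; [exists U|rewrite inE in Ux *|rewrite inE in Uy *].
- move=> x W; rewrite {1}nbhsE => -[_ [[U oU <-] Ux] UW].
  have [|V Vx VU] := reg (set_val x) U; first exact: open_nbhs_nbhs.
  exists (set_val @^-1` V); first exact: (cont x V Vx).
  move=> z zV; apply: UW; apply: VU => B Bz.
  have [|t [Vt Bt]] := zV (set_val @^-1` B); first exact: (cont z B Bz).
  by exists (set_val t).
Qed.

End general_topology.

(** * The space Psi *)

(** The filter of convergence along A: its members contain all but finitely
    many elements of A. *)
Definition cofinite_in (A : set nat) : set_system nat :=
  [set S | finite_set (A `\` S)].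

#[local] Instance cofinite_in_filter A : Filter (cofinite_in A).
Proof.
split.
- by rewrite /cofinite_in/= setDT.
- by move=> S T fS fT; rewrite /cofinite_in/= setDIr finite_setU.
- by move=> S T ST; apply: sub_finite_set; exact: setDS.
Qed.

Section Psi.
Context {L : set (set nat)}.

Lemma Psi_cvg (A : L) : psi_nat @ cofinite_in (val A) --> (psi_set A : Psi L).
Proof.
apply: (@subbase_cvg _ (Psi_gen L)) => // U [[S _ <-] []//|].
move=> [B [F [fF ->]]] [[->]|[]//]; apply: sub_finite_set fF => n [An] nF.
by apply: contrapT => Fn; apply: nF; right; exists n.
Qed.

Lemma Psi_open_nat (S : set nat) : open (psi_nat @` S : set (Psi L)).
Proof. by apply: (@subbase_open _ (Psi_gen L)) => //; left; exists S. Qed.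

Lemma Psi_open_nbhs (A : L) (S : set nat) : cofinite_in (val A) S ->
  open ([set psi_set A] `|` psi_nat @` (val A `&` S) : set (Psi L)).
Proof.
move=> AS; apply: (@subbase_open _ (Psi_gen L)) => //; right.
exists A, (val A `\` S); split=> //; congr (_ `|` psi_nat @` _).
by rewrite setDD.
Qed.

End Psi.

(** * The space Y *)

Section Y_space.
Context {L : set (set nat)} {D : int -> set (set nat)}.
Hypothesis DL : forall k, D k `<=` L.
Hypothesis adL : almost_disjoint L.
Hypothesis Ddisj : forall j k : int, j <> k -> D j `&` D k = set0.

Local Notation Delta := (Psi_Delta L).
Local Notation DeltaP := (Psi_Delta_part L D).
Local Notation Y := (bfY Delta DeltaP).

Lemma ynat_subproof (k : int) (n : nat) :
  (k, psi_nat n) \in [set p : int * Psi L | ~ Delta p.2 \/ DeltaP p.1 p.2].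
Proof. by apply/mem_set; left => -[]. Qed.

Definition ynat k n : Y := SigSub (ynat_subproof k n).

Definition in_L {k A} (h : D k A) : L := SigSub (mem_set (DL k A h)).

Lemma yset_subproof k A (h : D k A) : (k, psi_set (in_L h)) \in
  [set p : int * Psi L | ~ Delta p.2 \/ DeltaP p.1 p.2].
Proof. by apply/mem_set; right; exists (in_L h). Qed.

Definition yset {k A} (h : D k A) : Y := SigSub (yset_subproof k A h).

Variant Y_spec : Y -> Prop :=
  | Y_spec_nat k n : Y_spec (ynat k n)
  | Y_spec_set k A (h : D k A) : Y_spec (yset h).

Lemma YP (y : Y) : Y_spec y.
Proof.
case: y => -[k [A|n]] p.
- have h : D k (val A).
    by have /set_mem[[]|[B /= h [<-]]] := p; first by exists A.
  suff -> : exist _ (k, psi_set A) p = yset h by exact: Y_spec_set.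
  by apply/val_inj; congr (_, psi_set _); exact/val_inj.
- suff -> : exist _ (k, psi_nat n) p = ynat k n by exact: Y_spec_nat.
  exact/val_inj.
Qed.

Lemma ynat_inj k n k' n' : ynat k n = ynat k' n' -> k = k' /\ n = n'.
Proof. by move=> [-> ->]. Qed.

(** As the D k are disjoint, a point of Y over a member of L is determined by
    this member. *)
Lemma yset_eq k A (h : D k A) k' (h' : D k' A) : yset h = yset h'.
Proof.
have [kk'|/eqP kk'] := eqVneq k k'.
  subst k'; by apply/val_inj; congr (_, psi_set _); exact/val_inj.
by have : (D k `&` D k') A by []; rewrite Ddisj.
Qed.

(** A subbasic set containing the point over A contains the points of levels k
    and k + 1 over all n in some neighbourhood of A in Psi. *)
Lemma Y_cvg k A (h : D k A) j : j = k \/ j = k + 1 ->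
  ynat j @ cofinite_in A --> yset h.
Proof.
move=> jk; apply: (@subbase_cvg _ (@bfY_gen _ Delta DeltaP)) => // U.
move=> [[i [V [oV VD ->]]] [_ /VD]|]; first by case; exists (in_L h).
move=> [i [V [oV ->]]] [[/= ik [Vh _]]|[_ [_ []]]]; last by exists (in_L h).
have VA : cofinite_in A (psi_nat @^-1` V).
  by apply: (Psi_cvg (in_L h)); exact: open_nbhs_nbhs.
apply: (@filterS _ (cofinite_in A) _ _ _ _ VA) => n Vn.
have nD : ~ Delta (psi_nat n) by case.
by case: jk => ->; [left|right]; rewrite -ik; split=> //; split=> //; left.
Qed.

Lemma Y_open_nat k n : open [set ynat k n].
Proof.
apply: (@subbase_open _ (@bfY_gen _ Delta DeltaP)) => //; left.
exists k, (psi_nat @` [set n]); split; first exact: Psi_open_nat.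
  by move=> _ [m _ <-] [].
apply/seteqP; split=> [_ ->|y [<- [_ -> e]]]; first by split=> //; exists n.
by case: y e => -[i x] p /= e; apply/val_inj; rewrite /= e.
Qed.

(** A criterion of openness, converse to [Y_cvg]; the points over psi_nat n
    impose no condition because they are isolated. *)
Lemma Y_open (U : set Y) :
  (forall k A (h : D k A), U (yset h) ->
     cofinite_in A [set n | U (ynat k n) /\ U (ynat (k + 1) n)]) ->
  open U.
Proof.
move=> HU; rewrite openE => y; case: (YP y) => [k n|k A h] Uy.
  rewrite /interior nbhsE; exists [set ynat k n]; last by move=> _ ->.
  by split=> //; exact: Y_open_nat.
have oV := Psi_open_nbhs (in_L h) _ (HU k A h Uy).
set V := (X in open X) in oV.
rewrite /interior nbhsE.
exists (layer k (V `&` (~` Delta `|` DeltaP k)) `|`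
        layer (k + 1) (V `\` Delta)).
  split.
    apply: (@subbase_open _ (@bfY_gen _ Delta DeltaP)) => //.
    by right; exists k, V.
  by left; split=> //; split; [left|right; exists (in_L h)].
move=> z; case: (YP z) => [i n|i B hB].
  by move=> [[/= ->]|[/= ->]] [[//|[m [_ [? ?]] [<-]]]].
move=> [[/= ik [[/= [BA]|[]//] _]]|[_ [_ []]]]; last by exists (in_L hB).
by subst B; rewrite (yset_eq _ _ hB _ h).
Qed.

Lemma Y_closed1 (y : Y) : closed [set y].
Proof.
rewrite -openC; apply: Y_open => k A h _.
apply: (@sub_finite_set _ _ [set n | y = ynat k n \/ y = ynat (k + 1) n]).
  move=> n [_] /not_andP[/contrapT <-|/contrapT <-]; by [left|right].
case: (YP y) => [i m|i B hB]; last first.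
  rewrite (_ : [set _ | _] = set0)//.
  by apply/seteqP; split=> // n [].
by apply: sub_finite_set (finite_set1 m) => n [|] /ynat_inj[_ ->].
Qed.

Lemma Y_accessible : accessible_space Y.
Proof.
move=> x y xy; exists (~` [set y]); split.
- exact/closed_openC/Y_closed1.
- by apply/mem_set/eqP.
- by apply/mem_set => /=; exact.
Qed.

Definition lvl (y : Y) : int := (val y).1.

(** The clopen set around the point over A consists of that point and of
    points over elements of A.  Any other member B of L meets A in a finite set,
    so the point over B is not in its closure.  The bound on the levels keeps it
    away from the points at infinity. *)
Lemma Y_clopen_nbhs (y : Y) W : nbhs y W -> exists C,
  [/\ clopen C, C y, C `<=` W & forall z, C z -> lvl y <= lvl z <= lvl y + 1].
Proof.
case: (YP y) => [k n|k A h] nW.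
  exists [set ynat k n]; split=> //.
  - by split; [exact: Y_open_nat|exact: Y_closed1].
  - by move=> _ ->; exact: nbhs_singleton.
  - by move=> _ ->; rewrite /lvl/=; lia.
pose star := [set z | exists2 n, A n & z = ynat k n \/ z = ynat (k + 1) n].
exists ([set yset h] `|` (W `&` star)); split.
- split.
    apply: Y_open => j B hB [e|[_ [n _ []]]//].
    have /= [jk BA] : j = k /\ B = A by case: e => -> ->.
    subst j B.
    have W0 : cofinite_in A (ynat k @^-1` W) by apply: (Y_cvg k A h); [left|].
    have W1 : cofinite_in A (ynat (k + 1) @^-1` W).
      by apply: (Y_cvg k A h); [right|].
    apply: sub_finite_set (filterI W0 W1) => n [An nC].
    split=> // -[W0n W1n]; apply: nC; split; right; split=> //; exists n => //.
      by left.
    by right.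
  rewrite -openC; apply: Y_open => j B hB nC.
  have BA : B <> A.
    move=> BA; subst B; apply: nC; left; exact: yset_eq.
  apply: sub_finite_set (adL B A (DL _ _ hB) (DL _ _ h) BA) => n [Bn nCn].
  split=> //; apply: contrapT => nAn; apply: nCn.
  by split => -[//|[_ [m Am [|] /ynat_inj[_ nm]]]]; apply: nAn; rewrite nm.
- by left.
- by move=> z [->|[]//]; exact: nbhs_singleton.
- by move=> z [->|[_ [n _ [->|->]]]]; rewrite /lvl/=; lia.
Qed.

Lemma Y_completely_regular (R : realType) : completely_regular_T1 Y.
Proof.
apply: (clopen_completely_regular R); first exact: Y_accessible.
by move=> y W /Y_clopen_nbhs[C [? ? ? _]]; exists C.
Qed.

(** * The space Y with its two ends *)

Local Notation Ys := (bfYs Delta DeltaP).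
Local Notation pbase := (@pinfty_base _ Delta DeltaP).
Local Notation nbase := (@ninfty_base _ Delta DeltaP).

(** At the boundary level m the two kinds of points behave differently: only
    points over natural numbers belong to the basic sets of index m. *)
Lemma pbase_nat m k n : pbase m (ys_of (ynat k n)) <-> m <= k.
Proof.
split=> [[//|[y [[i im [ik _]]|[i im [_ [B _ Be]]]] [ye]]]|mk].
- by rewrite ye in ik; rewrite /= in ik; rewrite ik.
- by rewrite ye in Be.
- by right; exists (ynat k n) => //; left; exists k => //; split=> // -[].
Qed.

Lemma pbase_set m k A (h : D k A) : pbase m (ys_of (yset h)) <-> m < k.
Proof.
split=> [[//|[y [[i im [_ nD]]|[i im [ik _]]] [ye]]]|mk].
- by exfalso; apply: nD; rewrite ye; exists (in_L h).
- by rewrite ye in ik; rewrite /= in ik; rewrite ik.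
- right; exists (yset h) => //; right; exists k => //; split=> //.
  by exists (in_L h).
Qed.

Lemma nbase_nat m k n : nbase m (ys_of (ynat k n)) <-> k <= m.
Proof.
split=> [[//|[y [[i im [ik _]]|[i im [_ [B _ Be]]]] [ye]]]|mk].
- by rewrite ye in ik; rewrite /= in ik; rewrite ik.
- by rewrite ye in Be.
- by right; exists (ynat k n) => //; left; exists k => //; split=> // -[].
Qed.

Lemma nbase_set m k A (h : D k A) : nbase m (ys_of (yset h)) <-> k < m.
Proof.
split=> [[//|[y [[i im [_ nD]]|[i im [ik _]]] [ye]]]|mk].
- by exfalso; apply: nD; rewrite ye; exists (in_L h).
- by rewrite ye in ik; rewrite /= in ik; rewrite ik.
- right; exists (yset h) => //; right; exists k => //; split=> //.
  by exists (in_L h).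
Qed.

Lemma pbase_lvl m y : pbase m (ys_of y) -> m <= lvl y.
Proof.
by case: (YP y) => [k n /pbase_nat//|k A h /pbase_set]; exact: ltW.
Qed.

Lemma lvl_pbase m y : m < lvl y -> pbase m (ys_of y).
Proof.
by case: (YP y) => [k n /ltW ?|k A h ?]; [exact/pbase_nat|exact/pbase_set].
Qed.

Lemma nbase_lvl m y : nbase m (ys_of y) -> lvl y <= m.
Proof.
by case: (YP y) => [k n /nbase_nat//|k A h /nbase_set]; exact: ltW.
Qed.

Lemma lvl_nbase m y : lvl y < m -> nbase m (ys_of y).
Proof.
by case: (YP y) => [k n /ltW ?|k A h ?]; [exact/nbase_nat|exact/nbase_set].
Qed.

Lemma pbase_open m : open (pbase m).
Proof.
apply: (@subbase_open _ (@bfYs_gen _ Delta DeltaP)) => //.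
by left; right; exists m.
Qed.

Lemma nbase_open m : open (nbase m).
Proof.
apply: (@subbase_open _ (@bfYs_gen _ Delta DeltaP)) => //.
by right; exists m.
Qed.

Lemma image_open (U : set Y) : open U -> open (ys_of @` U : set Ys).
Proof.
move=> oU; apply: (@subbase_open _ (@bfYs_gen _ Delta DeltaP)) => //.
by left; left; exists U.
Qed.

(** The traces on Y of the basic neighbourhoods of the ends are open: a point
    over A has neighbours on its own level k and on the level k + 1, both within
    the range allowed when k > m, respectively k < m. *)
Lemma ys_of_continuous : continuous (ys_of : Y -> Ys).
Proof.
move=> y.
have nF : Filter (nbhs y) by exact: nbhs_filter.
apply: (@subbase_cvg _ (@bfYs_gen _ Delta DeltaP)) => // U.
move=> [[[V oV <-] [z Vz [zy]]|[m _ <-] Uy]|[m _ <-] Uy].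
- apply: (@filterS _ (nbhs y) _ V) => [t Vt|]; first by exists t.
  rewrite -zy; exact: open_nbhs_nbhs.
- apply: open_nbhs_nbhs; split=> //; apply: Y_open => k A h /pbase_set mk.
  rewrite /cofinite_in/= (_ : _ `\` _ = set0)//; apply/seteqP; split=> // n.
  by move=> [_]; apply; split; apply/pbase_nat; lia.
- apply: open_nbhs_nbhs; split=> //; apply: Y_open => k A h /nbase_set mk.
  rewrite /cofinite_in/= (_ : _ `\` _ = set0)//; apply/seteqP; split=> // n.
  by move=> [_]; apply; split; apply/nbase_nat; lia.
Qed.

Lemma nbhs_pinfty (W : set Ys) : nbhs ys_pinfty W -> exists m, pbase m `<=` W.
Proof.
suff /[apply] : filter_from setT pbase --> (ys_pinfty : Ys).
  by move=> [m _ mW]; exists m.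
apply: (@subbase_cvg _ (@bfYs_gen _ Delta DeltaP)) => //.
  apply: filter_from_filter; first by exists 0.
  move=> i j _ _; exists (Num.max i j + 1) => // -[|y|].
  - by move=> [//|[]].
  - by move=> /pbase_lvl yij; split; apply: lvl_pbase; lia.
  - by split; left.
move=> U [[[V _ <-] []//|[m _ <-] _]|[m _ <-] [//|[]//]].
by exists m.
Qed.

Lemma nbhs_ninfty (W : set Ys) : nbhs ys_ninfty W -> exists m, nbase m `<=` W.
Proof.
suff /[apply] : filter_from setT nbase --> (ys_ninfty : Ys).
  by move=> [m _ mW]; exists m.
apply: (@subbase_cvg _ (@bfYs_gen _ Delta DeltaP)) => //.
  apply: filter_from_filter; first by exists 0.
  move=> i j _ _; exists (Num.min i j - 1) => // -[|y|].
  - by split; left.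
  - by move=> /nbase_lvl yij; split; apply: lvl_nbase; lia.
  - by move=> [//|[]].
move=> U [[[V _ <-] []//|[m _ <-] [//|[]//]]|[m _ <-] _].
by exists m.
Qed.

Lemma base_disjoint i j : i < j -> pbase j `<=` ~` nbase i.
Proof.
move=> ij [|y|] //; first by move=> [//|[]//].
  by move=> /pbase_lvl jy /nbase_lvl; lia.
by move=> _ [//|[]//].
Qed.

Lemma Ys_accessible : accessible_space Ys.
Proof.
suff T1 (x y : Ys) : x <> y -> exists2 U, open U & U x /\ ~ U y.
  move=> x y /eqP/T1[U oU [Ux Uy]]; exists U.
  by split=> //; exact/mem_set.
case: x => [|x|]; case: y => [|y|] // xy.
- exists (nbase (lvl y - 1)); first exact: nbase_open.
  by split; [left|move=> /nbase_lvl; lia].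
- exists (nbase 0); first exact: nbase_open.
  by split; [left|move=> [//|[]]].
- exists (ys_of @` setT); first by apply: image_open; exact: openT.
  by split; [exists x|move=> []].
- exists (ys_of @` (~` [set y])).
    by apply: image_open; exact/closed_openC/Y_closed1.
  split; first by exists x => // xy'; apply: xy; rewrite xy'.
  by move=> [z zy [/zy]].
- exists (ys_of @` setT); first by apply: image_open; exact: openT.
  by split; [exists x|move=> []].
- exists (pbase 0); first exact: pbase_open.
  by split; [left|move=> [//|[]]].
- exists (pbase (lvl y + 1)); first exact: pbase_open.
  by split; [left|move=> /pbase_lvl; lia].
Qed.

(** In each case the closure of a neighbourhood is bounded by the complement
    of a disjoint open set.  For an end, this open set is a basic neighbourhood
    of the other end; for a point of Y with clopen neighbourhood C, it consists
    of the rest of Y and of neighbourhoods of the ends missing the levels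
    of C. *)
Lemma Ys_regular_T1 : regular_T1 Ys.
Proof.
split; first exact: Ys_accessible.
move=> [|y|] W.
- move=> /nbhs_ninfty[m mW]; exists (nbase (m - 2)).
    by apply: open_nbhs_nbhs; split; [exact: nbase_open|left].
  have sub : nbase (m - 2) `<=` ~` pbase (m - 1).
    by apply: subsetCr; apply: base_disjoint; lia.
  move=> z /(closure_disjoint_open _ _ (pbase_open _) sub) zp; apply: mW.
  case: z zp => [_|z zp|/(_ (or_introl erefl))//]; first by left.
  apply: lvl_nbase; rewrite ltNge; apply/negP => mz.
  by apply: zp; apply: lvl_pbase; lia.
- move=> /ys_of_continuous /Y_clopen_nbhs[C [[oC cC] Cy CW Clvl]].
  exists (ys_of @` C).
    by apply: open_nbhs_nbhs; split; [exact: image_open|exists y].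
  pose V := nbase (lvl y - 1) `|` ys_of @` (~` C) `|` pbase (lvl y + 2).
  have oV : open V.
    apply: openU; last exact: pbase_open.
    by apply: openU; [exact: nbase_open|apply/image_open/closed_openC].
  have sub : ys_of @` C `<=` ~` V.
    move=> _ [z Cz <-] [[/nbase_lvl|[t Ct [tz]]]|/pbase_lvl].
    + by have := Clvl z Cz; lia.
    + by apply: Ct; rewrite tz.
    + by have := Clvl z Cz; lia.
  move=> z /(closure_disjoint_open _ _ oV sub); case: z => [|z zV|].
  + by case; left; left; left.
  + by apply: CW; apply: contrapT => Cz; apply: zV; left; right; exists z.
  + by case; right; left.
- move=> /nbhs_pinfty[m mW]; exists (pbase (m + 2)).
    by apply: open_nbhs_nbhs; split; [exact: pbase_open|left].
  have sub : pbase (m + 2) `<=` ~` nbase (m + 1).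
    by apply/base_disjoint; lia.
  move=> z /(closure_disjoint_open _ _ (nbase_open _) sub) zp; apply: mW.
  case: z zp => [/(_ (or_introl erefl))//|z zp|_]; last by left.
  apply: lvl_pbase; rewrite ltNge; apply/negP => mz.
  by apply: zp; apply: lvl_nbase; lia.
Qed.

(** * Continuous real functions *)

Section real_function.
Context {R : realType}.
Hypothesis gap : forall M N : set (set nat), M `<=` L -> N `<=` L ->
  ~ countable M -> ~ countable N -> M `&` N = set0 ->
  ~ exists C : set nat, separates C M N.
Hypothesis Dunc : forall k : int, ~ countable (D k).
Context (g : Ys -> R).
Hypothesis cg : continuous g.

Definition below (k : int) (c : R) : set (set nat) :=
  [set A | exists h : D k A, g (ys_of (yset h)) < c].

Lemma layer_cvg {k A} (h : D k A) j : j = k \/ j = k + 1 ->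
  g (ys_of (ynat j n)) @[n --> cofinite_in A] --> g (ys_of (yset h)).
Proof.
by move=> jk W /cg /ys_of_continuous /(Y_cvg k A h j jk).
Qed.

(** Otherwise the values of g on level k + 1 would give a set separating
    uncountably many members of D k from uncountably many members of
    D (k + 1). *)
Lemma below_succ (k : int) (c d : R) : c < d ->
  ~ countable (below k c) -> ~ countable (below (k + 1) d).
Proof.
move=> cd kc cM.
have DB : D (k + 1) `<=` below (k + 1) d `|` (D (k + 1) `\` below (k + 1) d).
  by rewrite setDUK// => A [].
have unc : ~ countable (D (k + 1) `\` below (k + 1) d).
  move=> cN; apply: (Dunc (k + 1)).
  apply: (sub_countable (subset_card_le DB)); rewrite -bigcup2E.
  by apply: bigcup_countable => // -[|[|i]] _.
have belowD : below k c `<=` D k by move=> A [].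
apply: (gap _ _ _ _ kc unc).
- by apply: subset_trans (DL k).
- by move=> A [/DL].
- rewrite -subset0 => A [/belowD DA [DA' _]].
  suff : (D k `&` D (k + 1)) A by rewrite Ddisj//; lia.
  by [].
exists [set n | g (ys_of (ynat (k + 1) n)) < (c + d) / 2]; split.
- move=> A [h hc]; have := layer_cvg h (k + 1) (or_intror erefl).
  by move=> /cvgr_lt /(_ ((c + d) / 2)); apply; lra.
- move=> A [h nb]; have hd : d <= g (ys_of (yset h)).
    by rewrite leNgt; apply/negP => hd; apply: nb; exists h.
  have := layer_cvg h (k + 1) (or_introl erefl).
  move=> /cvgr_gt /(_ ((c + d) / 2)) /(_ ltac:(lra)).
  apply: sub_finite_set => n [An lt]; split=> // gt.
  by have := lt_trans lt gt; rewrite ltxx.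
Qed.

(** Starting below a between g(-oo) and g(+oo) on a very low level, the
    statement that every bound c > a has uncountably many values below it passes
    from one level to the next; on a very high level it contradicts that all the
    values exceed some b > a. *)
Lemma ends_le : g ys_pinfty <= g ys_ninfty.
Proof.
rewrite leNgt; apply/negP => lt.
set x := g ys_ninfty in lt *; set y := g ys_pinfty in lt *.
pose a := x + (y - x) / 3; pose b := x + (y - x) * 2 / 3.
have [m ma] : exists m, nbase m `<=` g @^-1` [set r | r < a].
  by apply: nbhs_ninfty; apply: (cvgr_lt _ (cg _)); rewrite /a -/x; lra.
have [p pb] : exists p, pbase p `<=` g @^-1` [set r | b < r].
  by apply: nbhs_pinfty; apply: (cvgr_gt _ (cg _)); rewrite /b -/y; lra.
have start : ~ countable (below (m - 1) a).
  suff -> : below (m - 1) a = D (m - 1) by [].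
  apply/seteqP; split=> [A []//|A h]; exists h.
  by apply: ma; apply/nbase_set; lia.
have step (n : nat) : forall c, a < c -> ~ countable (below (m - 1 + n%:Z) c).
  elim: n => [|n IH] c ac.
    rewrite addr0 => cc; apply: start; apply: sub_countable cc.
    by apply: subset_card_le => A [h ha]; exists h; exact: lt_trans ac.
  (* Of the margin c - a, half is kept for the levels below. *)
  rewrite intS [1 + _]addrC addrA.
  apply: (@below_succ _ ((a + c) / 2)); first lra.
  by apply: IH; lra.
have ab : a < b by rewrite /a /b; lra.
(* The level m - 1 + n exceeds p, even when p is below m. *)
pose n := `|p - m|%N.+2.
apply: (step n b ab); rewrite (_ : below _ _ = set0); first exact: countable0.
apply/seteqP; split=> // A [h hb].
have : pbase p (ys_of (yset h)) by apply/pbase_set; rewrite /n; lia.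
by move=> /pb /= bh; have := lt_trans hb bh; rewrite ltxx.
Qed.

End real_function.

End Y_space.

Theorem mainTheorem7 (R : realType) (L : set (set nat))
    (D : int -> set (set nat))
    (LusinL : Lusin_gap L)
    (LE : L = \bigcup_(k in [set: int]) D k)
    (D_uncountable : forall k : int, ~ countable (D k))
    (D_disjoint : forall j k : int, j <> k -> D j `&` D k = set0) :
  let Y := bfY (Psi_Delta L) (Psi_Delta_part L D) in
  let Ys := bfYs (Psi_Delta L) (Psi_Delta_part L D) in
  let Y_in_Ys : set Ys := range ys_of in
  [/\ completely_regular_T1 Y,
      regular_T1 (subspace_of (Y_in_Ys `|` [set ys_ninfty])),
      regular_T1 (subspace_of (Y_in_Ys `|` [set ys_pinfty])),
      regular_T1 Ys &
      forall f : Ys -> R, continuous f -> f ys_pinfty = f ys_ninfty].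
Proof.
have [_ _ adL gap] := LusinL.
have DL k : D k `<=` L by rewrite LE => A DA; exists k.
move=> Y Ys Y_in_Ys.
have reg : regular_T1 Ys by exact: Ys_regular_T1.
split=> //; [exact: Y_completely_regular|exact: regular_T1_subspace..|].
move=> f cf; apply: le_anti; apply/andP; split; first exact: ends_le.
rewrite -lerN2.
apply: (ends_le DL D_disjoint gap D_uncountable (fun z => - f z)) => z.
exact: (cvgN (cf z)).
Qed.
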